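(* For every graph $G$, $$\mathrm{con}(G) = \mathrm{tw}(L(G)) + 1,$$ where $\mathrm{con}(G)$ is the vertex congestion of $G$.
   Context: Graphs are finite, simple and undirected, and $G$ has at least one vertex. The line graph $L(G)$ has vertex set $E(G)$, two distinct elements being adjacent if and only if the corresponding edges of $G$ share an endpoint. A tree decomposition of a graph $H$ is a (nonempty) tree $T$ together with a collection of subsets of $V(H)$ (bags) indexed by the nodes of $T$ such that: every vertex of $H$ is in at least one bag; for each vertex $v$ of $H$, the nodes whose bags contain $v$ induce a connected subtree of $T$; and for each edge of $H$ some bag contains both its endpoints. Its width is the size of the largest bag minus 1, and the treewidth $\mathrm{tw}(H)$ is the minimum width of a tree decomposition of $H$ (so $\mathrm{tw}(H)=-1$ if $H$ has no vertices). A tree is sub-cubic if its maximum degree is at most 3. An embedding of $G$ is an injective map $\pi$ from $V(G)$ into the set of leaves of a sub-cubic tree $T$. For $vw\in E(G)$ let $P_{vw}$ be the path in $T$ from $\pi(v)$ to $\pi(w)$. The vertex congestion of $\pi$ is $$\max_{u \in V(T)} |\{vw \in E(G) : u \in V(P_{vw})\}|.$$ The vertex congestion $\mathrm{con}(G)$ of $G$ is the minimum vertex congestion over all sub-cubic trees $T$ and all embeddings $\pi$ of $G$ into the leaves of $T$. *)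

(* Defs.v *)
From HB Require Import structures.
From mathcomp Require Import all_boot all_order all_algebra.
From mathcomp Require Import boolp.

Set Implicit Arguments.
Unset Strict Implicit.
Unset Printing Implicit Defensive.

Import Order.TTheory GRing.Theory Num.Theory.

Record sgraph := SGraph {
  svertex :> finType;
  sedge : rel svertex;
  sedge_sym : symmetric sedge;
  sedge_irrefl : irreflexive sedge
}.

Notation "x -- y" := (sedge x y) (at level 30, no associativity).

Definition edges (G : sgraph) : {set {set G}} :=
  [set e : {set G} | [exists v, exists w, (v -- w) && (e == [set v; w])]].

Section LineGraph.
Variable G : sgraph.

Definition line_vertex := {e : {set G} | e \in edges G}.

Definition line_rel : rel line_vertex :=
  [rel e f | (e != f) && (val e :&: val f != set0)].

Lemma line_rel_sym : symmetric line_rel.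
Proof. by move=> e f; rewrite /line_rel /= eq_sym setIC. Qed.

Lemma line_rel_irrefl : irreflexive line_rel.
Proof. by move=> e; rewrite /line_rel /= eqxx. Qed.

Definition line_graph : sgraph := SGraph line_rel_sym line_rel_irrefl.
End LineGraph.

Definition connected_in (G : sgraph) (A : {set G}) : Prop :=
  {in A &, forall x y,
    connect [rel a b | [&& a \in A, b \in A & a -- b]] x y}.

(* [ucycle] accepts the empty sequence, and x--y--x for every edge; the cycles
   of a simple graph are those with at least three vertices. *)
Definition acyclic (G : sgraph) : Prop :=
  forall c : seq G, ucycle (@sedge G) c -> (size c <= 2)%N.

Definition is_tree (T : sgraph) : Prop :=
  [/\ (0 < #|T|)%N, connected_in [set: T] & acyclic T].

Definition degree (G : sgraph) (x : G) : nat := #|[set y | x -- y]|.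

Definition subcubic (T : sgraph) : Prop := forall x : T, (degree x <= 3)%N.

Definition leaf (T : sgraph) (x : T) : bool := degree x == 1%N.

Definition simple_path (G : sgraph) (x y : G) (p : seq G) : Prop :=
  [/\ path (@sedge G) x p, last x p = y & uniq (x :: p)].

(* In a tree there is exactly one simple path from x to y, so the existential
   quantifier ranges over a single path. *)
Definition path_vertices (T : sgraph) (x y : T) : {set T} :=
  [set u | `[< exists2 p, simple_path x y p & u \in x :: p >]].

Definition is_min (d : Order.disp_t) (X : porderType d)
    (P : X -> Prop) (m : X) : Prop :=
  P m /\ forall k, P k -> (m <= k)%O.

Section TreeDecomposition.
Variables (H T : sgraph) (bag : T -> {set H}).

Definition tree_decomposition : Prop :=
  [/\ is_tree T,
      forall v : H, exists t, v \in bag t,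
      forall v : H, connected_in [set t | v \in bag t]
    & forall v w : H, v -- w -> exists t, (v \in bag t) && (w \in bag t)].

Definition width : int := ((\max_(t : T) #|bag t|)%N%:Z - 1)%R.
End TreeDecomposition.

Definition has_width (H : sgraph) (k : int) : Prop :=
  exists (T : sgraph) (bag : T -> {set H}),
    tree_decomposition bag /\ width bag = k.

Section Congestion.
Variables (G T : sgraph) (pi : G -> T).

Definition leaf_embedding : Prop :=
  [/\ is_tree T, subcubic T, injective pi & forall v, leaf (pi v)].

Definition routed_edges (u : T) : {set {set G}} :=
  [set e : {set G} | [exists v, exists w,
    [&& v -- w, e == [set v; w] & u \in path_vertices (pi v) (pi w)]]].

Definition congestion : nat := \max_(u : T) #|routed_edges u|.
End Congestion.

Definition has_congestion (G : sgraph) (k : nat) : Prop :=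
  exists (T : sgraph) (pi : G -> T), leaf_embedding pi /\ congestion pi = k.

Lemma is_min_nat (P : nat -> Prop) : (exists n, P n) -> exists m, is_min P m.
Proof.
move=> exP; have exb : exists n, `[< P n >].
  by case: exP => n Pn; exists n; apply/asboolP.
case: (ex_minnP exb) => m /asboolP Pm le_m; exists m; split=> // k Pk.
by apply: le_m; apply/asboolP.
Qed.

Section OneNodeTree.
Definition unit_rel : rel unit := [rel x y | false].
Lemma unit_rel_sym : symmetric unit_rel. Proof. by []. Qed.
Lemma unit_rel_irrefl : irreflexive unit_rel. Proof. by []. Qed.
Definition unit_graph := SGraph unit_rel_sym unit_rel_irrefl.

Lemma unit_tree : is_tree unit_graph.
Proof.
split; first by rewrite card_unit.
- by case=> [] [] _ _; apply: connect0.
- by move=> [|x [|y c]] //= /andP[].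
Qed.
End OneNodeTree.

Lemma treewidth_exists (H : sgraph) : exists k : int, is_min (has_width H) k.
Proof.
have [|m [Pm le_m]] := @is_min_nat (fun n => has_width H (n%:Z - 1)%R).
  exists #|H|, unit_graph, (fun=> [set: H]); split.
    split; first exact: unit_tree.
    - by move=> v; exists tt; rewrite inE.
    - by move=> v [] [] _ _; apply: connect0.
    - by move=> v w _; exists tt; rewrite !inE.
  by rewrite /width (bigD1 tt) //= big1 ?maxn0 ?cardsT.
exists (m%:Z - 1)%R; split=> // k [T [bag [tdec wk]]].
rewrite -wk /width lerD2r lez_nat; apply: le_m.
by exists T, bag.
Qed.

Definition treewidth (H : sgraph) : int := sval (cid (treewidth_exists H)).

Lemma treewidthP (H : sgraph) : is_min (has_width H) (treewidth H).
Proof. exact: svalP (cid (treewidth_exists H)). Qed.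

Section Caterpillar.
Variable n : nat.
Local Notation V := ('I_n.+1 * bool)%type.

(* (i, true) is the i-th vertex of the spine and (i, false) the leaf attached
   to it. *)
Definition cat_parent : rel V :=
  fun a b => a.2 && (if b.2 then a.1.+1 == b.1 :> nat else a.1 == b.1).

Definition cat_rel : rel V := fun a b => cat_parent a b || cat_parent b a.

Lemma cat_rel_sym : symmetric cat_rel.
Proof. by move=> a b; rewrite /cat_rel /= orbC. Qed.

Lemma cat_rel_irrefl : irreflexive cat_rel.
Proof. by move=> [i []]; rewrite /cat_rel /cat_parent //= orbb gtn_eqF. Qed.

Definition caterpillar := SGraph cat_rel_sym cat_rel_irrefl.

Let rank (a : V) : nat := a.1.*2 + ~~ a.2.

Let rank_parent a b : cat_parent a b -> (rank a < rank b)%N.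
Proof.
case: a b => [i []] [j []] //=; rewrite /cat_parent /rank /= ?addn0 ?addn1.
  by move/eqP=> <-; rewrite doubleS.
by move/eqP=> <-.
Qed.

Let parent_inj a a' b : cat_parent a b -> cat_parent a' b -> a = a'.
Proof.
case: a a' b => [i []] [i' []] [j []] //; rewrite /cat_parent /=.
  by move=> /eqP <- /eqP[] /ord_inj ->.
by move=> /eqP -> /eqP ->.
Qed.

Let nbr_parent a b : cat_rel a b -> (rank b <= rank a)%N -> cat_parent b a.
Proof. by case/orP=> // /rank_parent; rewrite ltnNge => /negPf->. Qed.

Lemma caterpillar_acyclic : acyclic caterpillar.
Proof.
move=> c /andP[cyc uniq_c]; rewrite leqNgt; apply/negP=> size_c.
have [x0 x0c] : exists x, x \in c.
  by case: c size_c {cyc uniq_c} => // x c _; exists x; rewrite mem_head.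
case: (arg_maxnP (fun x : V => rank x) x0c) => x xc max_x.
have [i c' Ec] := rot_to xc.
have mem_c : {subset x :: c' <= c} by move=> y; rewrite -Ec mem_rot.
move: cyc uniq_c size_c; rewrite -(rot_cycle i) -(rot_uniq i) -(size_rot i) Ec.
case: c' Ec mem_c => [|y [|z s]] // Ec mem_c.
rewrite /cycle rcons_path => /andP[/andP[xy _] lx] /= uniq_c _.
set l := last z s in lx.
have lc : l \in z :: s by apply: mem_last.
have py : cat_parent y x.
  by apply: nbr_parent xy _; apply: max_x; apply: mem_c; rewrite !inE eqxx orbT.
have pl : cat_parent l x.
  apply: nbr_parent; first by rewrite -[cat_rel _ _]/(caterpillar.(sedge) x l) sedge_sym.
  by apply: max_x; apply: mem_c; rewrite inE in_cons lc !orbT.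
move: uniq_c; rewrite -(parent_inj pl py) => /and3P[_ /negP[]].
by rewrite in_cons in lc *.
Qed.

Lemma caterpillar_connected : connected_in [set: caterpillar].
Proof.
rewrite /connected_in; set e : rel caterpillar := [rel a b | _].
have esym : connect_sym e.
  by apply: sym_connect_sym => a b; rewrite /e /= !inE; apply: cat_rel_sym.
have spine m (ltm : (m < n.+1)%N) : connect e (ord0, true) (Ordinal ltm, true).
  elim: m ltm => [|m IHm] ltm.
    by apply: eq_connect0; congr (_, _); apply: val_inj.
  apply: connect_trans (IHm (ltnW ltm)) _; apply: connect1.
  by rewrite /e /= !inE /cat_rel /cat_parent /= eqxx.
have to0 a : connect e (ord0, true) a.
  case: a => [[i lti] []]; first exact: spine.
  apply: connect_trans (spine i lti) _; apply: connect1.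
  by rewrite /e /= !inE /cat_rel /cat_parent /= eqxx.
by move=> x y _ _; apply: connect_trans (to0 y); rewrite esym.
Qed.

Lemma caterpillar_tree : is_tree caterpillar.
Proof.
split; [|exact: caterpillar_connected | exact: caterpillar_acyclic].
by apply/card_gt0P; exists ((ord0, true) : V).
Qed.

Lemma caterpillar_leaf (i : 'I_n.+1) : leaf ((i, false) : caterpillar).
Proof.
apply/cards1P; exists ((i, true) : V); apply/setP=> [[j []]].
  by rewrite !inE /cat_rel /cat_parent /= xpair_eqE andbT.
by rewrite !inE /cat_rel /cat_parent /= xpair_eqE andbF.
Qed.

Lemma caterpillar_subcubic : subcubic caterpillar.
Proof.
move=> [i []]; last by rewrite (eqP (caterpillar_leaf i)).
pose s : seq V := [:: (i, false); (inord i.+1, true); (inord i.-1, true)].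
rewrite /degree; apply: leq_trans (card_size s).
apply: subset_leq_card; apply/subsetP=> -[j []]; rewrite inE => /orP[] /eqP Ej.
- suff ->: j = inord i.+1 by rewrite !inE eqxx orbT.
  by apply: val_inj; rewrite /= inordK // Ej.
- suff ->: j = inord i.-1 by rewrite !inE eqxx !orbT.
  by apply: val_inj; rewrite /= inordK -Ej /= ?ltn_ord.
- by rewrite -[j]Ej mem_head.
- by [].
Qed.
End Caterpillar.

Lemma con_exists (G : sgraph) : exists k : nat, is_min (has_congestion G) k.
Proof.
apply: is_min_nat.
pose pi (v : G) : caterpillar #|G| := (widen_ord (leqnSn _) (enum_rank v), false).
exists (congestion pi), (caterpillar #|G|), pi; split=> //; split.
- exact: caterpillar_tree.
- exact: caterpillar_subcubic.
- by move=> v w [] /ord_inj/enum_rank_inj.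
- by move=> v; apply: caterpillar_leaf.
Qed.

Definition con (G : sgraph) : nat := sval (cid (con_exists G)).

Lemma conP (G : sgraph) : is_min (has_congestion G) (con G).
Proof. exact: svalP (cid (con_exists G)). Qed.

(* Main.v *)
Require Import Defs.
From mathcomp Require Import all_boot all_order all_algebra.
From mathcomp Require Import boolp zify.

(** Routing the edges of G along an embedding into T makes the sets of edges
    routed through the nodes of T a tree decomposition of L(G). Conversely, given
    a tree decomposition of L(G), the edges at a vertex v form a clique, so by the
    Helly property of subtrees some node a(v) has all of them in its bag. Hang a
    leaf for v below a(v), with the edges at v as its bag, and split every node
    into a path with the same bag to make the tree sub-cubic. The nodes whose bag
    contains vw still form a subtree, so this subtree contains the whole path
    between the leaves of v and w, and congestion is at most the bag size. *)

Set Implicit Arguments.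
Unset Strict Implicit.
Unset Printing Implicit Defensive.

(** * Simple paths and connected sets in acyclic graphs *)

Section Paths.
Variable G : sgraph.
Implicit Types (A : {set G}) (x y : G) (p : seq G).

Definition induced_rel A : rel G := [rel a b | [&& a \in A, b \in A & a -- b]].

Lemma induced_rel_sym A : connect_sym (induced_rel A).
Proof.
by apply: sym_connect_sym => a b; rewrite /induced_rel /= andbCA sedge_sym.
Qed.

Lemma connected_in_simple_path A x y :
    connected_in A -> x \in A -> y \in A ->
  exists2 p, simple_path x y p & {subset x :: p <= A}.
Proof.
move=> conA xA yA; have /connectP[p0 p0_path ->] := conA x y xA yA.
case/shortenP: p0_path => p p_path p_uniq _.
exists p; first by split=> //; apply: sub_path p_path => a b /and3P[].
move=> z; rewrite inE => /predU1P[-> //|].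
elim: p x {xA p_uniq} p_path => //= w p IHp x /andP[/and3P[_ wA _] p_path].
by rewrite inE => /predU1P[-> //|]; apply: IHp p_path.
Qed.

(* An excursion of the path outside A would close up to a cycle through A. *)
Lemma simple_path_sub A x y p :
    acyclic G -> connected_in A -> x \in A -> y \in A ->
  simple_path x y p -> {subset p <= A}.
Proof.
move=> acyG conA + yA; elim: p x => //= z p IHp x xA [].
rewrite [path _ _ _]/= => /andP[xz p_path] p_last.
rewrite cons_uniq => /andP[x_notin zp_uniq].
have [zA|zNA] := boolP (z \in A).
  by move=> u; rewrite inE => /predU1P[-> //|]; apply: (IHp z).
have has_p : has (mem A) p.
  apply/hasP; exists y => //; case: p p_last {IHp p_path x_notin zp_uniq} => /=.
    by move=> zy; rewrite zy yA in zNA.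
  by move=> w p <-; apply: mem_last.
case/split_find: has_p p_path zp_uniq x_notin => b s1 s2 bA s1NA.
rewrite cat_path rcons_path => /andP[/andP[s1_path s1b] _] zp_uniq x_notin.
have [c [c_path c_last c_uniq] cA] := connected_in_simple_path conA bA xA.
(* The excursion leaves [x] for [z], runs through [s1] outside [A], returns at [b], and [c] leads
   from [b] back to [x] inside [A]. *)
have /acyG : ucycle (@sedge G) (z :: s1 ++ b :: c).
  apply/andP; split.
    by rewrite /= rcons_cat cat_path s1_path /= s1b rcons_path c_path c_last.
  rewrite -cat_cons cat_uniq c_uniq andbT; apply/andP; split.
    by move: zp_uniq; rewrite -cats1 -catA -cat_cons cat_uniq => /andP[].
  apply/hasPn => u /cA uA; rewrite inE negb_or.
  apply/andP; split; first by apply: contraNneq zNA => <-.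
  by apply: contraNN s1NA => us1; apply/hasP; exists u.
(* This makes [c] nonempty, so that the cycle has at least three vertices. *)
have: b != x.
  by apply: contraNneq x_notin => <-; rewrite inE mem_cat mem_rcons mem_head orbT.
case: c c_last {c_path c_uniq cA} => [/= -> /eqP //|c1 c _ _ ].
by rewrite /= size_cat /=; lia.
Qed.

Lemma path_vertices_sub A x y :
    acyclic G -> connected_in A -> x \in A -> y \in A ->
  path_vertices x y \subset A.
Proof.
move=> acyG conA xA yA; apply/subsetP => u; rewrite inE => /asboolP[p p_path].
by rewrite inE => /predU1P[-> //|]; apply: simple_path_sub p_path _.
Qed.

Lemma path_vertices_ends x y :
  connected_in [set: G] -> x \in path_vertices x y /\ y \in path_vertices x y.
Proof.
move=> conG.
have [p p_path _] := connected_in_simple_path conG (in_setT x) (in_setT y).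
by split; rewrite inE; apply/asboolP; exists p; rewrite ?mem_head //;
  case: p_path => _ <- _; apply: mem_last.
Qed.

Lemma path_vertices_sym x y : path_vertices x y = path_vertices y x.
Proof.
wlog suff: x y / {subset path_vertices x y <= path_vertices y x}.
  by move=> sub; apply/setP => u; apply/idP/idP; apply: sub.
move=> u; rewrite !inE => /asboolP[p [p_path p_last p_uniq] up].
have rev_p : rev (x :: p) = y :: rev (belast x p).
  by rewrite lastI rev_rcons p_last.
apply/asboolP; exists (rev (belast x p)).
  split; last by rewrite -rev_p rev_uniq.
    by rewrite -p_last rev_path (eq_path (e' := @sedge G)) // => a b; apply: sedge_sym.
  by rewrite -[LHS](last_cons x) -rev_p rev_cons last_rcons.
by rewrite -rev_p mem_rev.
Qed.

(** Each vertex is joined to [x] by an initial segment of a simple path, and all vertices of that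
    path belong to the set. *)
Lemma path_vertices_connected x y : connected_in (path_vertices x y).
Proof.
have to_x u : u \in path_vertices x y ->
    connect (induced_rel (path_vertices x y)) x u.
  rewrite inE => /asboolP[p p_path up].
  have p_sub : {subset x :: p <= path_vertices x y}.
    by move=> w wp; rewrite inE; apply/asboolP; exists p.
  case: p_path => + _ _; move: up p_sub; move: (path_vertices x y) => A.
  elim: p x => [|z p IHp] x; rewrite inE.
    by move/eqP=> -> _ _; apply: connect0.
  case/predU1P=> [-> _ _|up p_sub /=]; first exact: connect0.
  case/andP=> xz p_path; apply: (@connect_trans _ _ z); last first.
    by apply: IHp up _ p_path => v vp; apply: p_sub; rewrite inE vp orbT.
  by apply: connect1; rewrite /induced_rel /= xz !p_sub // !inE eqxx ?orbT.
move=> u w /to_x + /to_x; rewrite induced_rel_sym; exact: connect_trans.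
Qed.

End Paths.

(** * Rooted trees and the Helly property of their subtrees *)

(** The depth is any measure that decreases towards the root, not necessarily the distance to it.
    Trees built from parent functions then need no separate proofs of connectedness and
    acyclicity. *)
Record rooting (X : finType) := Rooting {
  root : X;
  parent : X -> X;
  depth : X -> nat;
  parent_root : parent root = root;
  depth_parent : forall x, x != root -> depth (parent x) < depth x
}.

Section Rooting.
Variables (X : finType) (R : rooting X).
Implicit Types (x y : X) (A : {set X}).

Lemma depth_root x : x != root R -> depth R (root R) < depth R x.
Proof.
have [n] := ubnP (depth R x); elim: n x => // n IHn x le_n xr.
have par_lt := depth_parent xr.
have [<- //|/IHn lt_r] := eqVneq (parent R x) (root R).
exact: ltn_trans (lt_r (leq_trans par_lt le_n)) par_lt.
Qed.

Lemma parent_neq x : x != root R -> parent R x != x.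
Proof. by move/depth_parent; apply: contraTneq => ->; rewrite ltnn. Qed.

Lemma depth_fconnect x y :
  fconnect (parent R) x y -> y = x \/ depth R y < depth R x.
Proof.
case/connectP => s + ->; elim: s x => [|c s IHs] x /=; first by left.
case/andP=> /eqP <- /IHs; have [->|/depth_parent lt_p] := eqVneq x (root R).
  by rewrite parent_root.
by case=> [->|lt_l]; right=> //; apply: ltn_trans lt_p.
Qed.

(** The inequality removes the loop at the root, which is its own parent. *)
Definition parent_rel : rel X :=
  fun x y => (x != y) && ((parent R x == y) || (parent R y == x)).

Lemma parent_rel_sym : symmetric parent_rel.
Proof. by move=> x y; rewrite /parent_rel eq_sym orbC. Qed.

Lemma parent_rel_irrefl : irreflexive parent_rel.
Proof. by move=> x; rewrite /parent_rel eqxx. Qed.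

Definition parent_graph := SGraph parent_rel_sym parent_rel_irrefl.

(** Connectedness of [A] in a form that is easy to check on constructed trees: climbing from any
    member stays in [A] until it reaches [t]. *)
Definition subtree_top A t :=
  t \in A /\
  {in A, forall x, x != t -> x != root R /\ parent R x \in A}.

Lemma subtree_top_depth A t x :
  subtree_top A t -> x \in A -> x != t -> depth R t < depth R x.
Proof.
case=> tA closA; have [n] := ubnP (depth R x).
elim: n x => // n IHn x le_n xA xt; have [xr pA] := closA x xA xt.
have par_lt := depth_parent xr.
have [<- //|/IHn lt_t] := eqVneq (parent R x) t.
exact: ltn_trans (lt_t (leq_trans par_lt le_n) pA) par_lt.
Qed.

Lemma subtree_connected A t :
  subtree_top A t -> connected_in (A : {set parent_graph}).
Proof.
case=> tA closA.
suff to_t x : x \in A -> connect (@induced_rel parent_graph A) x t.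
  move=> x y /to_t xt /to_t; rewrite induced_rel_sym; exact: connect_trans.
have [n] := ubnP (depth R x); elim: n x => // n IHn x le_n xA.
have [-> //|xt] := eqVneq x t.
have [xr pA] := closA x xA xt; have par_lt := depth_parent xr.
apply: (@connect_trans _ _ (parent R x)); last first.
  exact: IHn (leq_trans par_lt le_n) pA.
apply: connect1; rewrite /induced_rel /= xA pA /= /parent_rel eqxx /=.
by rewrite eq_sym parent_neq.
Qed.

Lemma parent_rel_parent x y :
  parent_rel x y -> depth R y <= depth R x -> parent R x = y.
Proof.
case/andP=> xy /orP[/eqP // | /eqP yx].
have yr : y != root R.
  by apply: contraNneq xy => yr; rewrite -yx yr parent_root eqxx.
by have := depth_parent yr; rewrite yx; lia.
Qed.

(* The deepest vertex of a cycle has its parent as both its neighbours. *)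
Lemma parent_graph_acyclic : acyclic parent_graph.
Proof.
move=> c /andP[cyc uniq_c]; rewrite leqNgt; apply/negP => size_c.
have [x0 x0c] : exists x, x \in c.
  by case: c size_c {cyc uniq_c} => // x c _; exists x; rewrite mem_head.
case: (arg_maxnP (depth R) x0c) => x xc max_x.
have [i c' Ec] := rot_to xc.
have mem_c y : y \in x :: c' -> depth R y <= depth R x.
  by rewrite -Ec mem_rot; apply: max_x.
move: cyc uniq_c size_c; rewrite -(rot_cycle i) -(rot_uniq i) -(size_rot i) Ec.
case: c' mem_c {Ec} => [|y [|z s]] // mem_c.
rewrite /cycle rcons_path => /andP[/andP[xy _] lx] /= uniq_c _.
set l := last z s in lx.
have lc : l \in z :: s by apply: mem_last.
have py := parent_rel_parent xy (mem_c y _).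
have pl : parent R x = l.
  apply: parent_rel_parent; first by rewrite parent_rel_sym.
  by apply: mem_c; rewrite 2!inE lc !orbT.
move: uniq_c lc; rewrite -pl py ?inE ?eqxx ?orbT //.
by move=> /and3P[_ /negPf->].
Qed.

Lemma parent_graph_tree : is_tree parent_graph.
Proof.
split; [by apply/card_gt0P; exists (root R) | | exact: parent_graph_acyclic].
by apply: (@subtree_connected _ (root R)); split=> // x _ xr; rewrite inE.
Qed.

(** Climb from [x]. Before reaching [a], the current vertex is deeper than [a], hence is not [b], so
    its parent is again in both subtrees. *)
Lemma subtree_top_meet A B a b x :
    subtree_top A a -> subtree_top B b -> depth R b <= depth R a ->
  x \in A -> x \in B -> a \in B.
Proof.
move=> topA topB le_ba; have [n] := ubnP (depth R x).
elim: n x => // n IHn x le_n xA xB.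
have [<- //|xa] := eqVneq x a.
have lt_ax := subtree_top_depth topA xA xa.
have [xr pA] := topA.2 x xA xa.
have /(topB.2 x xB)[_ pB] : x != b.
  by apply: contraTneq lt_ax => ->; rewrite -leqNgt.
exact: IHn (leq_trans (depth_parent xr) le_n) pA pB.
Qed.

(* The deepest of the tops lies in all the subtrees. *)
Lemma subtree_helly (I : finType) (P : pred I) (A : I -> {set X}) :
    (forall i, exists t, subtree_top (A i) t) ->
    {in P &, forall i j, A i :&: A j != set0} ->
  exists t, {in P, forall i, t \in A i}.
Proof.
move=> /choice[top topA] meetA.
(* An empty family arises from an isolated vertex of the graph; any node will do. *)
have [i0 Pi0|P0] := pickP P; last first.
  by exists (root R) => i Pi; have := P0 i; rewrite [P i]Pi.
case: (arg_maxnP (fun i => depth R (top i)) Pi0) => i Pi max_i.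
exists (top i) => j Pj; have /set0Pn[x] := meetA i j Pi Pj.
by rewrite inE => /andP[]; apply: subtree_top_meet (topA i) (topA j) (max_i j Pj).
Qed.

End Rooting.

(** * Rooting an arbitrary tree *)

Section TreeRooting.
Variable T : sgraph.

(** The parent of [x] is the next vertex on a shortest path to [r], so the parent edges form a
    spanning tree inside [T]. For an edge of [T], the path in the spanning tree between its ends is
    confined to these two ends by acyclicity, hence is that edge. *)
Lemma tree_rooting :
  is_tree T -> exists R : rooting T, subrel (@sedge T) (parent_rel R).
Proof.
case=> /card_gt0P[r _] conT acyT.
have toP x : exists n, `[< exists2 p, simple_path x r p & size p = n >].
  have [p p_path _] := connected_in_simple_path conT (in_setT x) (in_setT r).
  by exists (size p); apply/asboolP; exists p.
pose d x := ex_minn (toP x).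
have par_ex x : exists y, if x == r then y = r else x -- y /\ d y < d x.
  have [_|xr] := eqVneq x r; first by exists r.
  rewrite {2}/d; case: ex_minnP => _ /asboolP[[|y p] [p_path p_last p_uniq] <-] _.
    by move: xr; rewrite -p_last eqxx.
  case/andP: p_path => xy p_path; exists y; split=> //.
  rewrite /d /= ltnS; case: ex_minnP => m _; apply; apply/asboolP.
  by exists p => //; split=> //; case/andP: p_uniq.
have [par parP] := choice par_ex.
have par_r : par r = r by have := parP r; rewrite eqxx.
have par_d x : x != r -> d (par x) < d x.
  by move=> /negPf xr; have := parP x; rewrite xr; case.
exists (Rooting par_r par_d) => x y xy; set R := Rooting _ _.
have sub_R : subrel (parent_rel R) (@sedge T).
  move=> a b /andP[ab /= /orP[]/eqP Eab].
    have := parP a; rewrite Eab; case: eqP => [ar br|_ []//].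
    by rewrite ar br eqxx in ab.
  have := parP b; rewrite Eab; case: eqP => [br ar|_ []]; last by rewrite sedge_sym.
  by rewrite ar br eqxx in ab.
have [_ conR _] := parent_graph_tree R.
have [p [p_path p_last p_uniq] _] :=
  connected_in_simple_path conR (in_setT x) (in_setT y).
have con_xy : connected_in [set x; y].
  move=> a b /set2P[]-> /set2P[]->; rewrite ?connect0 //; apply: connect1.
    by rewrite /= !inE !eqxx orbT.
  by rewrite /= !inE !eqxx orbT sedge_sym.
have p_sub : {subset p <= [set x; y]}.
  apply: (@simple_path_sub T [set x; y] x y p) => //; rewrite ?inE ?eqxx ?orbT //.
  by split=> //; apply: sub_path p_path.
case: p p_path p_last p_uniq p_sub => [_ /= Exy|z p /andP[xz _] _ p_uniq p_sub].
  by move: xy; rewrite Exy sedge_irrefl.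
have /set2P[zx|<- //] := p_sub z (mem_head _ _).
by move: p_uniq; rewrite zx /= mem_head.
Qed.

(** The top is a member of least depth. *)
Lemma connected_in_subtree (R : rooting T) (A : {set T}) :
    subrel (@sedge T) (parent_rel R) -> A != set0 -> connected_in A ->
  exists t, subtree_top R A t.
Proof.
move=> subR /set0Pn[x0 x0A] conA.
case: (arg_minnP (depth R) x0A) => t tA min_t; exists t; split=> // x xA xt.
have xr : x != root R.
  apply: contraNneq xt => xr; have [->|/depth_root] := eqVneq t (root R).
    by rewrite xr.
  by rewrite -xr ltnNge min_t.
split=> //; apply: contraT => pNA.
(* If the parent of x is not in A, then no path in A leaves the descendants
   of x, whereas t is not one of them. *)
have closD a b : fconnect (parent R) a x -> induced_rel A a b ->
    fconnect (parent R) b x.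
  move=> ax /and3P[aA bA /subR/andP[_ /orP[]/eqP Eab]]; last first.
    by apply: connect_trans ax; rewrite -Eab; apply: fconnect1.
  have ax' : a != x by apply: contraNneq pNA => <-; rewrite Eab.
  case/connectP: ax => -[|c s] /=; first by move=> _ /esym/eqP; rewrite (negPf ax').
  by case/andP=> /eqP <- s_path ->; rewrite Eab in s_path *; apply/connectP; exists s.
have /connectP[p p_path p_last] := conA x t xA tA.
have /depth_fconnect[Ext|] : fconnect (parent R) t x.
  have: fconnect (parent R) x x by exact: connect0.
  rewrite {}p_last; move: {1 2 4}x p_path; elim: p => //= b p IHp a /andP[ab p_path].
  by move=> /closD/(_ ab); apply: IHp.
- by rewrite Ext eqxx in xt.
- by rewrite ltnNge min_t.
Qed.
End TreeRooting.

(** * Attaching new leaves to a rooted tree *)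

Section Hang.
Variables (X Y : finType) (R : rooting X) (a : Y -> X).

Definition hang_parent (u : X + Y) : X + Y :=
  inl (match u with inl x => parent R x | inr y => a y end).

Definition hang_depth (u : X + Y) : nat :=
  match u with inl x => depth R x | inr y => (depth R (a y)).+1 end.

Lemma hang_parent_root : hang_parent (inl (root R)) = inl (root R).
Proof. by rewrite /hang_parent parent_root. Qed.

Lemma hang_depth_parent u :
  u != inl (root R) -> hang_depth (hang_parent u) < hang_depth u.
Proof. by case: u => //= x; apply: depth_parent. Qed.

Definition hang := Rooting hang_parent_root hang_depth_parent.

(** New nodes are pendant, so they extend a subtree without moving its top as long as they hang
    below its members. *)
Lemma hang_subtree (A : {set X}) (S : {set X + Y}) t :
    subtree_top R A t -> (forall x, (inl x \in S) = (x \in A)) ->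
    (forall y, inr y \in S -> a y \in A) ->
  subtree_top hang S (inl t).
Proof.
case=> tA closA inlS inrS; split; first by rewrite inlS.
case=> [x|y] uS ut; rewrite /= /hang_parent inlS; last by split=> //; apply: inrS.
by apply: closA; rewrite -?inlS.
Qed.

End Hang.

(** * Making a rooted tree sub-cubic *)

(* Each vertex x is replaced by a path (x, 0), (x, 1), ..., the children of x
   being attached to distinct vertices of this path, so that every degree is at
   most 3; no child is attached to the last vertex, which is therefore a leaf. *)
Section Spine.
Variables (X : finType) (R : rooting X).
Local Notation V := (X * 'I_#|X|.+1)%type.

(** The position, on the path of its parent, where the path of [x] is attached. It is less than
    [#|X|], which keeps the last position [ord_max] free. *)
Definition slot (x : X) : 'I_#|X|.+1 := widen_ord (leqnSn _) (enum_rank x).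

Lemma slot_inj : injective slot.
Proof. by move=> x y /(congr1 val) /= /ord_inj/enum_rank_inj. Qed.

Definition spine_root : V := (root R, ord0).

Definition spine_parent (u : V) : V :=
  if u.2 != ord0 then (u.1, inord u.2.-1)
  else if u.1 == root R then u else (parent R u.1, slot u.1).

(** A lexicographic order: positions stay below [#|X|.+1], so one level of depth in [R] outweighs
    any of them. *)
Definition spine_depth (u : V) : nat := depth R u.1 * #|X|.+1 + u.2.

Lemma spine_parent_root : spine_parent spine_root = spine_root.
Proof. by rewrite /spine_parent /= !eqxx. Qed.

Lemma spine_depth_parent u :
  u != spine_root -> spine_depth (spine_parent u) < spine_depth u.
Proof.
case: u => x j; rewrite /spine_parent /spine_depth /=.
have [->|j0 _] := eqVneq j ord0; last first.
  by rewrite ltn_add2l inordK ?prednK ?lt0n // ltnW.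
rewrite xpair_eqE eqxx andbT => /[dup] xr /negPf -> /=.
have lt_slot : enum_rank x < #|X|.+1 by apply: leq_trans (ltn_ord _) _.
rewrite addn0 (@leq_trans ((depth R (parent R x)).+1 * #|X|.+1)) //.
  by rewrite mulSn addnC ltn_add2r.
by rewrite leq_mul2r depth_parent ?orbT.
Qed.

Definition spine := Rooting spine_parent_root spine_depth_parent.

(** This leaves at most two children: the next position on the same path and, as [slot] is
    injective, a single path attached at [u]. *)
Lemma spine_child (u v : V) :
    spine_parent v = u -> v != u ->
  (v.1 = u.1 /\ v.2 = u.2.+1 :> nat) \/ (v.2 = ord0 /\ slot v.1 = u.2).
Proof.
case: v => x j <-; rewrite /spine_parent /=.
have [->|j0 _] := eqVneq j ord0; last first.
  by left; split=> //=; rewrite inordK ?prednK ?lt0n // ltnW.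
by have [//|_ _] := eqVneq x (root R); [rewrite eqxx | right].
Qed.

Lemma spine_subcubic : subcubic (parent_graph spine).
Proof.
(* The parent and the two possible children; the default [u.1] stands in when no vertex has slot
   [u.2]. *)
move=> u; pose s : seq V :=
  [:: spine_parent u; (u.1, inord u.2.+1);
      (odflt u.1 [pick x | slot x == u.2], ord0)].
apply: leq_trans (card_size s); apply: subset_leq_card; apply/subsetP => v.
rewrite inE => /andP[uv /orP[/eqP <-|/eqP vu]]; first exact: mem_head.
rewrite eq_sym in uv; case: (spine_child vu uv) => [] [].
  case: v {vu uv} => x j /= -> Ej; rewrite !inE.
  suff ->: j = inord u.2.+1 by rewrite eqxx orbT.
  by apply: val_inj; rewrite /= inordK -Ej.
case: v {vu uv} => x j /= -> Ex; rewrite !inE; apply/orP; right; apply/orP; right.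
case: pickP => [y /eqP|/(_ x)]; last by rewrite Ex eqxx.
by rewrite -Ex => /slot_inj ->.
Qed.

Lemma spine_leaf (x : X) : leaf ((x, ord_max) : parent_graph spine).
Proof.
have X_gt0 : 0 < #|X| by apply/card_gt0P; exists x.
set u := (x, ord_max).
have ur : u != spine_root.
  by rewrite xpair_eqE negb_and -(inj_eq val_inj) /= -lt0n X_gt0 orbT.
apply/cards1P; exists (spine_parent u); apply/setP => v; rewrite !inE.
apply/idP/eqP => [/andP[uv /orP[/eqP //|/eqP vu]]|->]; last first.
  by rewrite /= /parent_rel eqxx /= eq_sym (@parent_neq _ spine u ur).
rewrite eq_sym in uv; case: (spine_child vu uv) => [] [_] /=.
  by move=> Ev; have := ltn_ord v.2; rewrite Ev ltnn.
by move/(congr1 val) => /= Ev; have := ltn_ord (enum_rank v.1); rewrite Ev ltnn.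
Qed.

(** Climbing changes the first component only at position 0, and there it is a parent step of
    [R]. *)
Lemma spine_subtree (A : {set X}) t :
  subtree_top R A t -> subtree_top spine [set u : V | u.1 \in A] (t, ord0).
Proof.
case=> tA closA; split; first by rewrite inE.
case=> x j; rewrite inE /= => xA; rewrite !xpair_eqE /spine_parent /=.
have [->|j0] := eqVneq j ord0; last by rewrite !andbF inE.
by rewrite !andbT => /(closA x xA)[xr pA]; rewrite xr (negPf xr) inE.
Qed.

End Spine.

(** * From an embedding to a tree decomposition *)

Lemma set2_inj (T : finType) (a b c d : T) :
  [set a; b] = [set c; d] -> a != b -> (a, b) = (c, d) \/ (a, b) = (d, c).
Proof.
move=> E; have : a \in [set c; d] by rewrite -E set21.
have : b \in [set c; d] by rewrite -E set22.
by move=> /set2P[]-> /set2P[]->; rewrite ?eqxx //; [right | left].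
Qed.

Section Routing.
Variable G : sgraph.

Lemma sedge_neq (v w : G) : v -- w -> v != w.
Proof. by apply: contraTneq => ->; rewrite sedge_irrefl. Qed.

Lemma edgesP (e : {set G}) :
  reflect (exists v w, v -- w /\ e = [set v; w]) (e \in edges G).
Proof.
rewrite inE; apply: (iffP existsP) => [[v /existsP[w /andP[vw /eqP->]]]|].
  by exists v, w.
by case=> v [w [vw ->]]; exists v; apply/existsP; exists w; rewrite vw eqxx.
Qed.

Variables (T : sgraph) (pi : G -> T).

Lemma mem_routed_edges u v w : v -- w ->
  ([set v; w] \in routed_edges pi u) = (u \in path_vertices (pi v) (pi w)).
Proof.
move=> vw; rewrite inE; apply/existsP/idP => [[a /existsP[b]]|uP].
  case/and3P=> ab /eqP/esym E.
  case: (set2_inj E (sedge_neq ab)) => [] [-> ->] //.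
  by rewrite path_vertices_sym.
by exists v; apply/existsP; exists w; rewrite vw eqxx.
Qed.

Lemma routed_edges_sub u : routed_edges pi u \subset edges G.
Proof.
apply/subsetP=> e; rewrite inE => /existsP[v /existsP[w /and3P[vw /eqP -> _]]].
by apply/edgesP; exists v, w.
Qed.

(** The nodes whose bags contain an edge form its routing path. Edges sharing an endpoint [x] have
    both their paths end at [pi x], so they meet in its bag. *)
Lemma width_congestion :
  leaf_embedding pi -> has_width (line_graph G) ((congestion pi)%:Z - 1)%R.
Proof.
case=> treeT _ _ _; have [_ conT _] := treeT.
pose bag u : {set line_graph G} := [set e | val e \in routed_edges pi u].
have ends (e : line_graph G) x : x \in val e -> e \in bag (pi x).
  case/edgesP: (valP e) => v [w [vw Ee]]; rewrite inE Ee mem_routed_edges //.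
  have [vP wP] := path_vertices_ends (pi v) (pi w) conT.
  by case/set2P=> ->.
exists T, bag; split.
  split=> // [e|e|e f /andP[_ /set0Pn[x]]].
  - case/edgesP: (valP e) => v [w [_ Ee]].
    by exists (pi v); apply: ends; rewrite Ee set21.
  - case/edgesP: (valP e) => v [w [vw Ee]].
    suff ->: [set u | e \in bag u] = path_vertices (pi v) (pi w).
      exact: path_vertices_connected.
    by apply/setP => u; rewrite 2![LHS]inE -mem_routed_edges // -Ee.
  - by rewrite inE => /andP[xe xf]; exists (pi x); rewrite !ends.
(* The elements of a bag carry proofs of being edges; [val] maps each bag bijectively onto the
   routed edges. *)
rewrite /width /congestion; congr (_ - 1)%R; congr (_%:Z)%R.
apply: eq_bigr => u _; rewrite -(card_imset _ val_inj).
congr #|pred_of_set _|; apply/setP => e; apply/imsetP/idP => [[f]|eR].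
  by rewrite inE => fR ->.
have eG := subsetP (routed_edges_sub u) e eR.
by exists (exist _ e eG); first rewrite inE.
Qed.

End Routing.

(** * From a tree decomposition to an embedding *)

Lemma congestion_width (G T : sgraph) (bag : T -> {set line_graph G}) :
    tree_decomposition bag ->
  exists2 k, has_congestion G k & k <= \max_(t : T) #|bag t|.
Proof.
case=> treeT cov con_bag adj.
have [R subR] := tree_rooting treeT.
pose A (e : line_graph G) := [set t | e \in bag t].
have topA e : exists t, subtree_top R (A e) t.
  apply: connected_in_subtree subR _ (con_bag e).
  by have [t te] := cov e; apply/set0Pn; exists t; rewrite inE.
pose star v := [set e : line_graph G | v \in val e].
have /choice[a starP] v : exists t, star v \subset bag t.
  have [e f|t tP] := @subtree_helly _ R _ (fun e => e \in star v) A topA.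
    (* Distinct edges at [v] are adjacent in the line graph and so share a bag; a single edge lies
       in some bag by covering. *)
    move=> ve vf; have [->|ef] := eqVneq e f.
      have [t te] := cov f; apply/set0Pn; exists t; rewrite !inE te //.
    have [|t /andP[te tf]] := adj e f.
      rewrite /= /line_rel /= ef; apply/set0Pn; exists v.
      by move: ve vf; rewrite !inE => -> ->.
    by apply/set0Pn; exists t; rewrite !inE te.
  by exists t; apply/subsetP => e /tP; rewrite inE.
(* Leaves are hung first, then every node becomes a path with constant bag; [pi v] is the free end
   of the path of [inr v]. *)
pose Q := spine (hang R a).
pose pi (v : G) : parent_graph Q := (inr v, ord_max).
pose bagQ (z : T + G) := match z with inl t => bag t | inr v => star v end.
have subQ (e : line_graph G) :
    connected_in ([set u | e \in bagQ u.1] : {set parent_graph Q}).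
  have [t topt] := topA e.
  have topH : subtree_top (hang R a) [set z | e \in bagQ z] (inl t).
    apply: hang_subtree topt _ _ => [x|v]; rewrite !inE //.
    by move=> ve; apply: (subsetP (starP v)); rewrite inE.
  suff ->: [set u : parent_graph Q | e \in bagQ u.1] =
      [set u | u.1 \in [set z | e \in bagQ z]].
    exact: subtree_connected (spine_subtree topH).
  by apply/setP => u; rewrite !inE.
exists (congestion pi).
  exists (parent_graph Q), pi; split=> //; split.
  - exact: parent_graph_tree.
  - exact: spine_subcubic.
  - by move=> v w [].
  - by move=> v; apply: spine_leaf.
apply/bigmax_leqP => u _.
(* Every new bag is contained in an old one, since [star v] lies in the bag of [a v]. *)
have [t le_t] : exists t, #|bagQ u.1| <= #|bag t|.
  by case: u.1 => [t|v]; [exists t | exists (a v); exact: subset_leq_card (starP v)].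
apply: leq_trans (leq_bigmax t); apply: leq_trans le_t.
apply: leq_trans (leq_imset_card val _); apply: subset_leq_card.
apply/subsetP => e eR; have eG := subsetP (routed_edges_sub pi u) e eR.
pose f : line_graph G := exist _ e eG; apply/imsetP; exists f => //.
have /edgesP[v [w [vw Ee]]] := eG.
rewrite Ee mem_routed_edges // in eR.
(* Both ends of the path have [f] in their bags, so connectedness puts [f] in the bag of every node
   between them. *)
suff: u \in [set u : parent_graph Q | f \in bagQ u.1] by rewrite inE.
apply: (subsetP (path_vertices_sub (@parent_graph_acyclic _ Q) (subQ f) _ _)) eR.
  by rewrite !inE /= Ee set21.
by rewrite !inE /= Ee set22.
Qed.

Theorem theorem2p4 (G : sgraph) (G_gt0 : (0 < #|G|)%N) :
  ((con G)%:Z = treewidth (line_graph G) + 1)%R.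
Proof.
(* An optimal embedding bounds the treewidth, and an optimal decomposition bounds the congestion. *)
have [[T [pi [emb_pi con_pi]]] min_con] := conP G.
have [[T' [bag [tdec_bag width_bag]]] min_tw] := treewidthP (line_graph G).
have := min_tw _ (width_congestion emb_pi); rewrite con_pi => le_tw.
have [k /min_con le_con le_k] := congestion_width tdec_bag.
move: le_tw; rewrite -width_bag /width.
have : (con G <= \max_(t : T') #|bag t|)%N by apply: leq_trans le_con le_k.
set m := (\max_t _)%N; lia.
Qed.
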